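(* Let $G$ be Goldberg's snark \#3, the graph on vertex set $\{1,\dots,24\}$ with edge set $\{9,10\},\{8,9\},\{9,13\},\{13,16\},\{15,16\},\{16,17\},\{10,17\},\{8,15\},\{5,7\},\{1,3\},\{1,2\},\{2,5\},\{2,4\},\{4,6\},\{6,7\},\{3,6\},\{18,20\},\{22,24\},\{19,22\},\{18,19\},\{19,21\},\{21,23\},\{20,23\},\{23,24\},\{7,15\},\{12,13\},\{1,10\},\{3,22\},\{4,11\},\{17,24\},\{14,21\},\{5,20\},\{8,18\},\{11,14\},\{12,14\},\{11,12\}$. A $G$ design of order $n$ exists if and only if $n \equiv 1$ or $64 \pmod{72}$.
   Context: All graphs are simple. For a graph $G$, a $G$ design of order $n$ is a partition of the edge set of the complete graph $K_n$ into edge sets of subgraphs each isomorphic to $G$. By convention the empty set is a $G$ design of order $1$. *)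

(* Defs.v *)
From mathcomp Require Import all_boot.

Set Implicit Arguments.
Unset Strict Implicit.
Unset Printing Implicit Defensive.

Record sgraph := SGraph {
  vertex :> finType;
  edges : {set {set vertex}};
  edges_card2 : forall e, e \in edges -> #|e| = 2
}.

Definition isomorphic (G H : sgraph) : Prop :=
  exists f : G -> H, bijective f /\
    forall x y : G, ([set f x; f y] \in edges H) = ([set x; y] \in edges G).

Lemma complete_card2 n (e : {set 'I_n}) :
  e \in [set e : {set 'I_n} | #|e| == 2] -> #|e| = 2.
Proof. by rewrite inE => /eqP. Qed.

Definition complete n : sgraph := SGraph (@complete_card2 n).

Record subgraph (G : sgraph) := Subgraph {
  sub_vertices : {set G};
  sub_edges : {set {set G}};
  sub_edgesP : sub_edges \subset edges G;
  sub_edges_vertices : forall e, e \in sub_edges -> e \subset sub_vertices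
}.

Section SubgraphAsGraph.
Variables (G : sgraph) (H : subgraph G).

Let V := {x : G | x \in sub_vertices H}.

Definition sgraph_of_sub_edges : {set {set V}} :=
  [set e : {set V} | [set val x | x in e] \in sub_edges H].

Lemma sgraph_of_sub_card2 e : e \in sgraph_of_sub_edges -> #|e| = 2.
Proof.
rewrite inE => /(subsetP (sub_edgesP H)) /edges_card2.
by rewrite card_imset //; apply: val_inj.
Qed.

Definition sgraph_of_sub : sgraph := SGraph sgraph_of_sub_card2.

End SubgraphAsGraph.

Definition is_design (G : sgraph) (n : nat)
    (D : {set {set {set complete n}}}) : Prop :=
  partition D (edges (complete n)) /\
  forall B, B \in D -> exists H : subgraph (complete n),
    sub_edges H = B /\ isomorphic G (sgraph_of_sub H).

Definition goldberg3_list : seq (nat * nat) :=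
  [:: (9, 10); (8, 9); (9, 13); (13, 16); (15, 16); (16, 17); (10, 17);
      (8, 15); (5, 7); (1, 3); (1, 2); (2, 5); (2, 4); (4, 6); (6, 7); (3, 6);
      (18, 20); (22, 24); (19, 22); (18, 19); (19, 21); (21, 23); (20, 23);
      (23, 24); (7, 15); (12, 13); (1, 10); (3, 22); (4, 11); (17, 24);
      (14, 21); (5, 20); (8, 18); (11, 14); (12, 14); (11, 12)].

(* The vertex labelled k in 1..24 is the ordinal k - 1 of 'I_24. *)
Definition goldberg3_edges : {set {set 'I_24}} :=
  [set [set p.1; p.2] | p : 'I_24 * 'I_24 & (p.1.+1, p.2.+1) \in goldberg3_list].

Lemma goldberg3_card2 e : e \in goldberg3_edges -> #|e| = 2.
Proof.
case/imsetP=> -[i j]; rewrite inE /= => ij ->; rewrite cards2.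
have /allP/(_ _ ij) : all (fun p => p.1 != p.2) goldberg3_list by [].
by rewrite /= eqSS -val_eqE /= => ->.
Qed.

Definition goldberg3 : sgraph := SGraph goldberg3_card2.

(* Main.v *)
Require Import Defs.
From mathcomp Require Import all_boot all_algebra ring zify.

Set Implicit Arguments.
Unset Strict Implicit.
Unset Printing Implicit Defensive.

(** Necessity: [G] is cubic with 36 edges, so 3 divides [n - 1] and 36 divides
    [n (n - 1) / 2].

    Sufficiency: a group divisible design with blocks of size 3 and [u] groups of
    size 6 exists for every [u >= 3]. Replace each of its points by 12 points,
    each of its blocks by a decomposition of K_{12,12,12}, and fill each group
    together with one common extra point by a design of order 73; this gives the
    order [72 u + 1]. If the six points of one group are instead given the weights
    21, 12, 12, 6, 6, 6, the blocks through them are replaced by decompositions of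
    K_{12,12,21}, K_{12,12,12} or K_{12,12,6}, that group is filled by a design of
    order 64, and the order is [72 (u - 1) + 64]. The orders 64, 73, 136, 145 and
    the three tripartite graphs are handled by explicit base blocks.

    For odd [u] the group divisible design is Bose's Steiner triple construction on
    Z_u x Z_3 with every point doubled. For [u = v + 1] with [v] odd, one
    difference class of that construction over Z_v is taken apart: only its
    triangles with constant doubling coordinate are kept, and the remaining edges
    form a lift of the doubled K_{3,3}, hence fall into six perfect matchings, one
    for each point of the new group. *)

(** * Decompositions as edge multiplicities *)

Definition labels : seq nat := iota 1 24.

Lemma label_in_edge i : i \in labels ->
  exists2 e, e \in goldberg3_list & (e.1 == i) || (e.2 == i).
Proof.
move=> il; apply/hasP; move: i il; apply/allP.
by vm_compute.
Qed.

Lemma edge_labels e : e \in goldberg3_list -> (e.1 \in labels) && (e.2 \in labels).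
Proof. by move: e; apply/allP; vm_compute. Qed.

Lemma edge_loopless e : e \in goldberg3_list -> e.1 != e.2.
Proof. by move: e; apply/allP; vm_compute. Qed.

Section Coverage.

Variable T : eqType.
Implicit Types (f : nat -> T) (bs : seq (nat -> T)) (x y : T).

Definition block_edges f : seq (T * T) :=
  [seq (f e.1, f e.2) | e <- goldberg3_list].

Definition family_edges bs : seq (T * T) :=
  flatten [seq block_edges f | f <- bs].

Definition joins x y (e : T * T) : bool := (e == (x, y)) || (e == (y, x)).

Definition coverage bs x y : nat := count (joins x y) (family_edges bs).

Definition is_block f : bool := uniq [seq f i | i <- labels].

(* [m] is a multigraph given by edge multiplicities; multiplicities make the
   union of two decompositions a plain sum. *)
Definition decomposable (m : T -> T -> nat) : Prop :=
  exists2 bs, all is_block bs & forall x y, coverage bs x y = m x y.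

Definition clique (P : pred T) x y : nat := [&& x != y, P x & P y].

Lemma joinsC x y : joins x y =1 joins y x.
Proof. by move=> e; rewrite /joins orbC. Qed.

Lemma coverageC bs x y : coverage bs x y = coverage bs y x.
Proof. exact/eq_count/joinsC. Qed.

Lemma eq_decomposable m m' :
  (forall x y, m x y = m' x y) -> decomposable m -> decomposable m'.
Proof. by move=> eqm [bs bl cv]; exists bs => // x y; rewrite cv. Qed.

Lemma decomposable0 : decomposable (fun _ _ => 0).
Proof. by exists [::]. Qed.

Lemma decomposableD m1 m2 : decomposable m1 -> decomposable m2 ->
  decomposable (fun x y => m1 x y + m2 x y).
Proof.
move=> [bs1 bl1 cv1] [bs2 bl2 cv2]; exists (bs1 ++ bs2).
  by rewrite all_cat bl1.
move=> x y; rewrite -cv1 -cv2 /coverage /family_edges.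
by rewrite map_cat flatten_cat count_cat.
Qed.

Lemma decomposable_sum (I : eqType) (s : seq I) (m : I -> T -> T -> nat) :
  (forall i, i \in s -> decomposable (m i)) ->
  decomposable (fun x y => \sum_(i <- s) m i x y).
Proof.
elim: s => [|i s IHs] dec.
  by apply: eq_decomposable decomposable0 => x y; rewrite big_nil.
have /eq_decomposable : forall x y, m i x y + \sum_(j <- s) m j x y =
    \sum_(j <- i :: s) m j x y by move=> x y; rewrite big_cons.
apply; apply: decomposableD; first by apply: dec; rewrite mem_head.
by apply: IHs => j js; apply: dec; rewrite inE js orbT.
Qed.

Lemma coverage_cons f bs x y :
  coverage (f :: bs) x y = count (joins x y) (block_edges f) + coverage bs x y.
Proof. exact: count_cat. Qed.

(** No vertex of G is isolated, so a property of the ends of all edges reaches every vertex of every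
    block. *)
Lemma family_vertices (P : pred T) bs :
  all (fun e => P e.1 && P e.2) (family_edges bs) ->
  all (fun f => all (fun i => P (f i)) labels) bs.
Proof.
elim: bs => [//|f bs IHbs].
have -> : family_edges (f :: bs) = block_edges f ++ family_edges bs by [].
rewrite all_cat => /andP[/allP Pf /IHbs bsP].
apply/andP; split=> //.
apply/allP => i /label_in_edge[e eG].
have /Pf /andP[P1 P2] : (f e.1, f e.2) \in block_edges f.
  by apply/mapP; exists e.
by case/orP=> /eqP <-.
Qed.

End Coverage.

(** * Transport along partial injections *)

Section Transport.

Variables (T T' : eqType) (h : T -> T') (P : pred T).
Hypothesis h_inj : {in P &, injective h}.

(** Blocks are composed with [h]. Injectivity is known only on [P], and the blocks stay inside [P]
    because their edges have positive multiplicity in [m]. *)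
Lemma decomposable_map (m : T -> T -> nat) (m' : T' -> T' -> nat) :
    (forall x y, 0 < m x y -> P x) ->
    {in P &, forall x y, m' (h x) (h y) = m x y} ->
    (forall x' y', 0 < m' x' y' ->
      exists x y, [/\ P x, P y, x' = h x & y' = h y]) ->
  decomposable m -> decomposable m'.
Proof.
move=> mP m'h m'P [bs bl cv].
pose es := family_edges bs.
have es_gt0 x y : (x, y) \in es -> 0 < m x y.
  move=> xyE; rewrite -cv -has_count; apply/hasP; exists (x, y) => //.
  by rewrite /joins eqxx.
have mC x y : m x y = m y x by rewrite -!cv coverageC.
have esP e : e \in es -> P e.1 && P e.2.
  case: e => x y /es_gt0 mxy /=.
  by rewrite (mP x y) //= (mP y x) // mC.
have esE : family_edges [seq h \o f | f <- bs] =
    [seq (h e.1, h e.2) | e <- es].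
  by rewrite /es /family_edges map_flatten -!map_comp; congr flatten.
have cvh : {in P &, forall x y,
    coverage [seq h \o f | f <- bs] (h x) (h y) = m x y}.
  move=> x y Px Py; rewrite -cv /coverage esE count_map.
  apply: eq_in_count => -[a b] /esP /= /andP[Pa Pb].
  by rewrite /joins /= !xpair_eqE !(inj_in_eq h_inj).
exists [seq h \o f | f <- bs].
  rewrite all_map.
  have bsP : all (fun f => all (fun i => P (f i)) labels) bs.
    by apply: family_vertices; apply/allP.
  have := conj bl bsP; move/andP; rewrite -all_predI; apply: sub_all.
  move=> f /andP[bf /allP fP].
  have -> : preim (fun f => h \o f) (@is_block T') f =
      uniq [seq h x | x <- [seq f i | i <- labels]] by rewrite -map_comp.
  rewrite map_inj_in_uniq //.
  by move=> _ _ /mapP[i iL ->] /mapP[j jL ->]; apply: h_inj; apply: fP.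
move=> x' y'.
case: (posnP (m' x' y')) => [m0 | /m'P[x [y [Px Py -> ->]]]]; last first.
  by rewrite cvh // m'h.
(* An edge covering this pair would be the image of an edge of positive multiplicity in [m], which
   [m'] would have to share. *)
rewrite m0; apply/eqP; case: posnP => //.
rewrite -has_count esE => /hasP[_ /mapP[[a b] abE ->]] jn.
have := es_gt0 _ _ abE; have /andP[/= Pa Pb] := esP _ abE.
suff -> : m a b = m' x' y' by rewrite m0.
by case/orP: jn => /eqP[<- <-]; rewrite m'h.
Qed.

Lemma decomposable_clique_map (P' : pred T') :
    (forall x, P x -> P' (h x)) ->
    (forall x', P' x' -> exists2 x, P x & x' = h x) ->
  decomposable (clique P) -> decomposable (clique P').
Proof.
move=> hP P'h; apply: decomposable_map => [x y|x y Px Py|x' y'].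
- by rewrite /clique lt0b => /and3P[].
- rewrite /clique (inj_in_eq h_inj) //.
  by rewrite (hP _ Px) (hP _ Py) (Px : P x) (Py : P y).
- rewrite /clique lt0b => /and3P[_ /P'h[x Px ->] /P'h[y Py ->]].
  by exists x, y.
Qed.

End Transport.

Definition complete_decomposable (n : nat) : Prop :=
  decomposable (clique (fun x : nat => x < n)).


Section CliqueOnSeq.

Variables (T : eqType) (s : seq T).
Hypothesis s_uniq : uniq s.

Lemma complete_decomposable_mem :
  complete_decomposable (size s) -> decomposable (clique (fun x => x \in s)).
Proof.
case Es: s => [|x0 s'].
  by move=> _; apply: eq_decomposable (decomposable0 _) => x y; rewrite /clique andbF.
rewrite -Es; apply: (decomposable_clique_map (h := nth x0 s)).
- by move=> i j ilt jlt /eqP; rewrite nth_uniq // => /eqP.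
- by move=> i; apply: mem_nth.
- by move=> x xs; exists (index x s); rewrite ?index_mem // nth_index.
Qed.

Lemma decomposable_mem_complete :
  decomposable (clique (fun x => x \in s)) -> complete_decomposable (size s).
Proof.
case Es: s => [|x0 s'].
  by move=> _; apply: eq_decomposable (decomposable0 _) => x y; rewrite /clique andbF.
rewrite -Es; apply: (decomposable_clique_map (h := index^~ s)).
- by move=> x y xs ys; apply: index_inj.
- by move=> x; rewrite index_mem.
- by move=> i ilt; exists (nth x0 s i); [apply: mem_nth | rewrite index_uniq].
Qed.

End CliqueOnSeq.

(** * Explicit decompositions *)

Definition sort_pair (e : nat * nat) : nat * nat :=
  if e.1 < e.2 then e else (e.2, e.1).

Definition lexico (p q : nat * nat) : bool :=
  (p.1 < q.1) || (p.1 == q.1) && (p.2 <= q.2).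

Definition arcs (N : nat) (adj : rel nat) : seq (nat * nat) :=
  [seq p <- [seq (x, y) | x <- iota 0 N, y <- iota 0 N]
     | (p.1 < p.2) && adj p.1 p.2].

Definition block_of_seq (b : seq nat) (i : nat) : nat := nth 0 b i.-1.

(** [arcs] comes out in lexicographic order and without repetitions, so one sort and one comparison
    of lists show that each edge is covered exactly once. *)
Definition valid_decomposition N adj (bs : seq (seq nat)) : bool :=
  let fs := map block_of_seq bs in
  all (@is_block _) fs &&
  (sort lexico (map sort_pair (family_edges fs)) == arcs N adj).

Lemma joins_sort_pair x y e : joins x y e = (sort_pair e == sort_pair (x, y)).
Proof.
case: e => a b; rewrite /joins /sort_pair /= !xpair_eqE.
case: ltngtP => ab; case: ltngtP => xy; rewrite ?xpair_eqE /=;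
  apply/idP/idP => [/orP[]/andP[/eqP ? /eqP ?] | /andP[/eqP ? /eqP ?]];
  subst; rewrite ?eqxx ?orbT //; move: ab xy; rewrite ?ltnn //;
  by move=> /ltnW; rewrite leqNgt => /negbTE ->.
Qed.

Lemma arcs_uniq N adj : uniq (arcs N adj).
Proof.
apply: filter_uniq; apply: allpairs_uniq; try exact: iota_uniq.
by move=> [a b] [c d] _ _ [-> ->].
Qed.

Lemma mem_arcs N adj x y :
  ((x, y) \in arcs N adj) = [&& x < N, y < N, x < y & adj x y].
Proof.
rewrite mem_filter /=.
have -> : ((x, y) \in [seq (x, y) | x <- iota 0 N, y <- iota 0 N]) =
    (x < N) && (y < N).
  apply/allpairsP/andP => [[[a b] [/= aN bN [-> ->]]]|[xN yN]].
    by rewrite !mem_iota in aN bN.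
  by exists (x, y); rewrite !mem_iota.
by rewrite andbC -!andbA.
Qed.

Lemma decomposable_of_check N adj bs : symmetric adj ->
    valid_decomposition N adj bs ->
  decomposable (fun x y => [&& x < N, y < N, x != y & adj x y] : nat).
Proof.
move=> adjC /andP[bl /eqP edgesE]; exists (map block_of_seq bs) => // x y.
rewrite /coverage (eq_count (joins_sort_pair x y)).
rewrite -(count_map sort_pair (pred1 (sort_pair (x, y)))).
rewrite -(permP (permEl (perm_sort lexico _))) edgesE count_uniq_mem ?arcs_uniq //.
rewrite /sort_pair /=; case: ltngtP => xy; rewrite mem_arcs ?xy ?ltnn ?andbF //=.
by rewrite adjC andbCA.
Qed.

(* Entry number [k] of a base block (counting from 1) is the image of vertex [k].
   The blocks were found by simulated annealing on the orbits of edges. The second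
   block of [base145] is 12 times the first, where 12^2 = -1 mod 145. The points
   for orders 64 and 136 are Z_63 and Z_135 with one fixed point, rotated by 3;
   a "short" block is invariant under the rotation of order 3, which acts on it as
   an automorphism of [G]. *)
Definition base73 : seq (seq nat) :=
  [:: [:: 21; 14; 61; 62; 45; 24; 68; 32; 35; 51; 63; 67; 26; 53; 60; 4; 57;
      58; 69; 43; 48; 42; 30; 18]].

Definition base145 : seq (seq nat) :=
  [:: [:: 81; 58; 53; 47; 68; 141; 63; 39; 134; 117; 45; 126; 51; 87; 10; 128;
      91; 32; 139; 67; 43; 84; 115; 44];
      [:: 102; 116; 56; 129; 91; 97; 31; 33; 13; 99; 105; 62; 32; 29; 120; 86;
      77; 94; 73; 79; 81; 138; 75; 93]].

Definition base64_full : seq (seq nat) :=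
  [:: [:: 1; 58; 45; 15; 51; 50; 11; 17; 37; 13; 25; 32; 54; 55; 47; 48; 9; 61;
      39; 60; 21; 31; 8; 46];
      [:: 45; 38; 12; 63; 29; 0; 21; 36; 33; 58; 37; 46; 28; 11; 50; 62; 30;
      53; 61; 9; 8; 14; 25; 20]].

Definition base64_short : seq (seq nat) :=
  [:: [:: 8; 53; 19; 55; 57; 5; 42; 0; 26; 40; 58; 16; 13; 37; 15; 11; 29; 36;
      32; 21; 34; 50; 47; 61];
      [:: 23; 48; 1; 32; 16; 28; 39; 60; 49; 22; 17; 38; 53; 59; 37; 6; 44; 58;
      27; 18; 11; 2; 7; 43]].

Definition base136_full : seq (seq nat) :=
  [:: [:: 126; 103; 123; 80; 45; 38; 75; 21; 104; 101; 59; 119; 106; 25; 92;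
      114; 58; 113; 90; 97; 61; 95; 33; 44];
      [:: 64; 127; 46; 14; 100; 101; 131; 110; 52; 20; 79; 50; 36; 116; 1; 112;
      77; 43; 121; 83; 84; 128; 11; 126];
      [:: 8; 97; 54; 90; 135; 89; 83; 115; 73; 99; 128; 55; 7; 104; 94; 122;
      25; 59; 12; 6; 0; 60; 131; 3];
      [:: 89; 62; 104; 101; 8; 45; 26; 69; 77; 9; 16; 20; 67; 19; 1; 117; 51;
      82; 42; 114; 66; 3; 25; 30];
      [:: 59; 117; 120; 33; 18; 16; 51; 25; 64; 129; 130; 85; 118; 10; 31; 75;
      35; 21; 7; 5; 19; 60; 38; 109]].

Definition base136_short : seq (seq nat) :=
  [:: [:: 12; 22; 93; 127; 98; 119; 107; 17; 29; 3; 129; 39; 37; 84; 8; 67; 57;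
      53; 112; 62; 82; 102; 74; 48];
      [:: 103; 48; 69; 121; 63; 70; 45; 90; 115; 114; 38; 83; 31; 128; 108; 93;
      13; 18; 3; 0; 76; 58; 25; 24]].

Definition base_tripartite12 : seq (seq nat) :=
  [:: [:: 21; 8; 35; 27; 15; 12; 0; 7; 17; 1; 2; 16; 24; 34; 30; 20; 25; 13;
      26; 4; 5; 14; 31; 9]].

Definition base_tripartite21 : seq (seq nat) :=
  [:: [:: 34; 8; 7; 37; 20; 21; 24; 25; 4; 15; 11; 39; 14; 17; 23; 0; 32; 5;
      12; 35; 29; 43; 18; 9];
      [:: 7; 17; 18; 40; 5; 3; 30; 34; 6; 27; 19; 0; 28; 25; 16; 11; 13; 21;
      43; 38; 2; 8; 20; 39];
      [:: 44; 20; 17; 7; 32; 26; 16; 23; 1; 21; 40; 13; 37; 10; 31; 3; 41; 33;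
      4; 8; 28; 43; 15; 0]].

Definition base_tripartite6 : seq (seq nat) :=
  [:: [:: 20; 2; 5; 28; 22; 21; 4; 29; 12; 3; 8; 23; 24; 25; 19; 10; 13; 0; 27;
      26; 7; 15; 16; 6];
      [:: 19; 7; 11; 29; 15; 23; 0; 10; 14; 28; 8; 22; 9; 27; 12; 26; 4; 16; 3;
      25; 17; 18; 1; 24]].

Definition develop (step : nat -> nat) (k : nat) (bs : seq (seq nat)) :=
  flatten [seq traject (map step) b k | b <- bs].

(** Numbers from [N] on stay fixed; these are the points 63 and 135 in the orders 64 and 136. *)
Definition rotate (N s x : nat) : nat := if x < N then (x + s) %% N else x.

Lemma complete_of_check n bs :
  valid_decomposition n (fun _ _ => true) bs -> complete_decomposable n.
Proof.
move=> /decomposable_of_check chk; apply: eq_decomposable (chk _) => // x y.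
by rewrite /clique andbT andbA andbC.
Qed.

Lemma complete_decomposable73 : complete_decomposable 73.
Proof.
by apply: (@complete_of_check _ (develop (rotate 73 1) 73 base73)); vm_compute.
Qed.

Lemma complete_decomposable145 : complete_decomposable 145.
Proof.
by apply: (@complete_of_check _ (develop (rotate 145 1) 145 base145)); vm_compute.
Qed.

Lemma complete_decomposable64 : complete_decomposable 64.
Proof.
(* Rotation by 3 has order 21 on Z_63, and a short block has only 7 images. This makes 2 * 21 + 2 *
   7 = 56 blocks, as 64 * 63 / 72 requires. *)
apply: (@complete_of_check _ (develop (rotate 63 3) 21 base64_full ++
                              develop (rotate 63 3) 7 base64_short)).
by vm_compute.
Qed.

Lemma complete_decomposable136 : complete_decomposable 136.
Proof.
apply: (@complete_of_check _ (develop (rotate 135 3) 45 base136_full ++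
                              develop (rotate 135 3) 15 base136_short)).
by vm_compute.
Qed.

(** The parts are 0..11, 12..23 and everything from 24 on, so only the third one varies in size. *)
Definition part (x : nat) : nat := minn 2 (x %/ 12).

Definition tripartite (w x y : nat) : nat :=
  [&& x < 24 + w, y < 24 + w & part x != part y].

Lemma tripartite_of_check w bs :
    valid_decomposition (24 + w) (fun x y => part x != part y) bs ->
  decomposable (tripartite w).
Proof.
move=> /decomposable_of_check chk; apply: eq_decomposable (chk _) => x y.
  by rewrite /tripartite; case: eqVneq => // ->; rewrite eqxx.
by rewrite eq_sym.
Qed.

Lemma tripartite12 : decomposable (tripartite 12).
Proof.
pose step x := x %/ 12 * 12 + (x + 1) %% 12.
by apply: (@tripartite_of_check _ (develop step 12 base_tripartite12)); vm_compute.
Qed.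

Lemma tripartite21 : decomposable (tripartite 21).
Proof.
(* Seven cycles of length 6 and one of length 3, each inside one part. The order 6 turns 3 base
   blocks into the 648 / 36 = 18 blocks needed. *)
pose step x := if x < 42 then x %/ 6 * 6 + (x + 1) %% 6 else 42 + (x + 1) %% 3.
by apply: (@tripartite_of_check _ (develop step 6 base_tripartite21)); vm_compute.
Qed.

Lemma tripartite6 : decomposable (tripartite 6).
Proof.
pose step x := if x < 24 then x %/ 4 * 4 + (x + 1) %% 4 else x.
by apply: (@tripartite_of_check _ (develop step 4 base_tripartite6)); vm_compute.
Qed.

(** * Designs from decompositions *)

Lemma uniq_map_inj (T T' : eqType) (f : T -> T') (s : seq T) :
  uniq (map f s) -> {in s &, injective f}.
Proof.
move=> fs_uniq x y xs ys eq_f; apply: (index_inj x xs ys).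
apply: (uniqP (f x) fs_uniq); rewrite ?inE ?size_map ?index_mem //.
by rewrite !(nth_map x) ?index_mem // !nth_index.
Qed.

Lemma eq_set2 (T : finType) (a b c d : T) :
  ([set a; b] == [set c; d]) = joins a b (c, d).
Proof.
rewrite /joins !xpair_eqE; apply/eqP/orP => [eqS|]; last first.
  by case=> /andP[/eqP -> /eqP ->] //; rewrite setUC.
have ha : a \in [set c; d] by rewrite -eqS set21.
have hb : b \in [set c; d] by rewrite -eqS set22.
have hc : c \in [set a; b] by rewrite eqS set21.
have hd : d \in [set a; b] by rewrite eqS set22.
case/set2P: ha => Ea; case/set2P: hb => Eb; case/set2P: hc => Ec;
  by case/set2P: hd => Ed; subst; rewrite ?eqxx; auto.
Qed.

Lemma mem_goldberg3 (x y : 'I_24) :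
  ([set x; y] \in goldberg3_edges) =
  ((x.+1, y.+1) \in goldberg3_list) || ((y.+1, x.+1) \in goldberg3_list).
Proof.
apply/imsetP/orP => [[[a b]]|].
  rewrite inE /= => abE /eqP; rewrite eq_set2 /joins.
  by case/orP=> /eqP[<- <-]; rewrite abE; auto.
case=> xyE; first by exists (x, y); rewrite ?in_set.
by exists (y, x); rewrite ?in_set //= setUC.
Qed.

Section Blocks.

Variables (n : nat) (f : nat -> complete n).
Hypothesis f_block : is_block f.

Let f_inj : {in labels &, injective f}.
Proof. exact: uniq_map_inj f_block. Qed.

Definition block_set : {set {set complete n}} :=
  [set E in [seq [set p.1; p.2] | p <- block_edges f]].

Lemma mem_block_set (x y : complete n) :
  ([set x; y] \in block_set) = has (joins x y) (block_edges f).
Proof.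
rewrite in_set; apply/mapP/hasP => [[[a b] abE /eqP]|[[a b] abE]].
  by rewrite eq_set2; exists (a, b).
by rewrite -eq_set2 => /eqP xyE; exists (a, b).
Qed.

Lemma block_set_edges : block_set \subset edges (complete n).
Proof.
apply/subsetP => E; rewrite in_set => /mapP[_ /mapP[e eG ->] ->] /=.
have /andP[l1 l2] := edge_labels eG.
rewrite inE cards2 (inj_in_eq f_inj) //.
by rewrite edge_loopless.
Qed.

Definition block_vertices : {set complete n} := [set x in [seq f i | i <- labels]].

Lemma block_set_vertices E : E \in block_set -> E \subset block_vertices.
Proof.
rewrite in_set => /mapP[_ /mapP[e /edge_labels /andP[l1 l2] ->] ->] /=.
by rewrite subUset !sub1set !in_set; apply/andP; split; apply: map_f.
Qed.

Definition block_subgraph : subgraph (complete n) :=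
  Subgraph block_set_edges block_set_vertices.

Lemma ord_label (i : 'I_24) : i.+1 \in labels.
Proof. by rewrite mem_iota /= ltnS. Qed.

Let vertex_of (i : 'I_24) : sgraph_of_sub block_subgraph.
Proof.
exists (f i.+1); rewrite in_set; apply/map_f/ord_label.
Defined.

Lemma block_isomorphic : isomorphic goldberg3 (sgraph_of_sub block_subgraph).
Proof.
exists vertex_of; split.
  apply: inj_card_bij => [i j [/f_inj eq_ij]|].
    by apply/val_inj/succn_inj/eq_ij; apply: ord_label.
  rewrite card_sig card_ord.
  apply: (@leq_trans (size [seq f i | i <- labels])); last by rewrite size_map.
  apply: leq_trans (card_size _); apply: subset_leq_card.
  by apply/subsetP => x; rewrite unfold_in /= in_set.
move=> x y; rewrite mem_goldberg3 in_set imsetU !imset_set1 /=.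
rewrite mem_block_set; apply/hasP/orP => [[_ /mapP[e eG ->]]|].
  have /andP[l1 l2] := edge_labels eG.
  rewrite /joins !xpair_eqE !(inj_in_eq f_inj) ?ord_label //.
  by rewrite -!xpair_eqE; case/orP=> /eqP; case: e eG {l1 l2} => a b eG [<- <-]; auto.
by case=> eG; eexists; try exact: (map_f _ eG); rewrite /joins eqxx ?orbT.
Qed.

End Blocks.

(** Coverage at least 1 makes the block edge sets cover all edges; coverage at most 1 makes them
    disjoint, since two different blocks sharing a pair would cover it twice. None is empty, as each
    contains the image of the edge {9, 10}. *)
Lemma design_of_decomposable n :
  complete_decomposable n ->
  exists D : {set {set {set complete n}}}, is_design goldberg3 D.
Proof.
move=> dec_n.
have [bs bl cv] : decomposable (clique (fun x : complete n => x \in enum 'I_n)).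
  by apply: complete_decomposable_mem; rewrite ?enum_uniq ?size_enum_ord.
have {}cv x y : coverage bs x y = (x != y).
  by rewrite cv /clique !mem_enum !andbT.
pose Bs := [seq block_set f | f <- bs].
have BsP B : B \in Bs -> exists2 f, is_block f & B = block_set f.
  rewrite /Bs; elim: (bs) bl => //= f fs IH /andP[bf /IH{}IH].
  by rewrite inE => /predU1P[-> | /IH //]; exists f.
have count_le x y :
    count (fun B : {set {set complete n}} => [set x; y] \in B) Bs <= coverage bs x y.
  rewrite /Bs count_map; elim: (bs) => // f fs IH.
  rewrite coverage_cons; apply: leq_add => //.
  change (([set x; y] \in block_set f) <= count (joins x y) (block_edges f)).
  by rewrite mem_block_set has_count; case: (count _ _).
have has_gt0 x y : 0 < coverage bs x y -> exists2 B, B \in Bs & [set x; y] \in B.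
  rewrite /Bs; elim: (bs) => // f fs IH; rewrite coverage_cons addn_gt0.
  case/orP=> [|/IH[B Bfs xyB]]; last by exists B; rewrite // inE Bfs orbT.
  by rewrite -has_count -mem_block_set; exists (block_set f); rewrite ?mem_head.
exists [set B in Bs]; split; last first.
  move=> B; rewrite in_set => /BsP[f bf ->].
  by exists (block_subgraph bf); split=> //; apply: block_isomorphic.
apply/and3P; split.
- rewrite eqEsubset; apply/andP; split; apply/subsetP => E.
    case/bigcupP=> B; rewrite in_set => /BsP[f bf ->].
    exact: subsetP (block_set_edges bf) E.
  move=> /edges_card2/eqP/cards2P[x [y [xy ->]]].
  have [|B BBs xyB] := has_gt0 x y; first by rewrite cv xy.
  by apply/bigcupP; exists B; rewrite ?in_set.
- apply/trivIsetP => A B; rewrite !in_set => AB BB neqAB.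
  rewrite -setI_eq0; apply/eqP/setP => E; rewrite in_set in_set0.
  apply/negP => /andP[EA EB].
  have [f bf defA] := BsP A AB.
  have : E \in edges (complete n).
    by rewrite (subsetP (block_set_edges bf)) // -defA.
  move=> /edges_card2/eqP/cards2P[x [y [xy defE]]].
  have : 1 < coverage bs x y.
    apply: leq_trans (count_le x y); rewrite -size_filter.
    apply: (@uniq_leq_size _ [:: A; B]); first by rewrite /= inE neqAB.
    by move=> C; rewrite mem_filter !inE => /orP[]/eqP->; rewrite -defE ?EA ?EB.
  by rewrite cv xy.
- rewrite in_set; apply/negP => /BsP[f bf /setP/(_ [set f 9; f 10])].
  rewrite in_set0 mem_block_set => /esym /hasP[].
  by exists (f 9, f 10); rewrite /joins ?eqxx // mem_head.
Qed.

(** * Necessity *)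

Lemma reverse_not_edge e : e \in goldberg3_list -> (e.2, e.1) \notin goldberg3_list.
Proof. by move: e; apply/allP; vm_compute. Qed.

(** The list holds each edge in one orientation only, so sums over the edge set become sums over a
    list, which can be evaluated. *)
Lemma sum_goldberg3 (F : {set 'I_24} -> nat) :
  \sum_(E in goldberg3_edges) F E =
  \sum_(e <- goldberg3_list) F [set inord e.1.-1; inord e.2.-1].
Proof.
pose to_ord (e : nat * nat) : 'I_24 * 'I_24 := (inord e.1.-1, inord e.2.-1).
have to_ordK e : e \in goldberg3_list ->
    ((to_ord e).1.+1, (to_ord e).2.+1) = e.
  case: e => a b /edge_labels; rewrite !mem_iota /= => /andP[/andP[a0 a25] /andP[b0 b25]].
  by rewrite !inordK ?prednK // -ltnS prednK.
have in_ord p : (p \in [set p : 'I_24 * 'I_24 | (p.1.+1, p.2.+1) \in goldberg3_list])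
    = (p \in map to_ord goldberg3_list).
  rewrite in_set; apply/idP/mapP => [pG|[e eG ->]].
    exists (p.1.+1, p.2.+1) => //; case: p pG => a b _ /=.
    by rewrite /to_ord /= !inord_val.
  by rewrite to_ordK.
rewrite big_imset /=; last first.
  move=> [a b] [c d]; rewrite !in_set /= => abE cdE /eqP.
  rewrite eq_set2 => /orP[/eqP[-> ->] // | /eqP[Ec Ed]].
  by have := reverse_not_edge abE; rewrite /= -Ec -Ed cdE.
rewrite (eq_bigl _ _ in_ord) -big_uniq; first by rewrite big_map.
rewrite map_inj_in_uniq; first by vm_compute.
by move=> e e' eG e'G eq_e; rewrite -(to_ordK e) // -(to_ordK e') // eq_e.
Qed.

Lemma card_goldberg3 : #|goldberg3_edges| = 36.
Proof. by rewrite -sum1_card sum_goldberg3 big_tnth sum1_card card_ord. Qed.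

Lemma degree_goldberg3 (i : 'I_24) :
  \sum_(E in goldberg3_edges) (i \in E) = 3.
Proof.
rewrite sum_goldberg3.
have incE e : e \in goldberg3_list ->
    (i \in [set inord e.1.-1; inord e.2.-1]) = ((e.1 == i.+1) || (e.2 == i.+1)).
  case: e => a b /edge_labels; rewrite !mem_iota /= => /andP[/andP[a0 a25] /andP[b0 b25]].
  rewrite in_set2 -!val_eqE /= !inordK -1?ltnS ?prednK //.
  by rewrite -!(eqSS i) !prednK // ![_ == i.+1]eq_sym.
rewrite (eq_big_seq (fun e => ((e.1 == i.+1) || (e.2 == i.+1) : nat))); last first.
  by move=> e eG; rewrite incE.
rewrite -big_mkcond sum1_count.
have /allP/(_ i.+1 (ord_label i))/eqP // : all (fun k =>
  count (fun e : nat * nat => (e.1 == k) || (e.2 == k)) goldberg3_list == 3) labels.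
by vm_compute.
Qed.

Section Necessity.

Variables (n : nat) (D : {set {set {set complete n}}}).
Hypothesis D_design : is_design goldberg3 D.

(** Restating the isomorphism as an injection of vertices lets edges and degrees of a block be
    counted in G. *)
Lemma design_block B : B \in D ->
  exists2 g : 'I_24 -> complete n, injective g &
    B = [set g @: (E : {set 'I_24}) | E in goldberg3_edges].
Proof.
case: D_design => _ /[apply] -[H [<- [F [F_bij F_edges]]]].
have F_inj : injective F by apply: bij_inj.
exists (fun i => val (F i)) => [i j /val_inj/F_inj //|].
have mapE (i j : 'I_24) : (fun i => val (F i)) @: [set i; j] =
    [set val x | x in [set F i; F j]].
  by rewrite !imsetU !imset_set1.
apply/setP => E; apply/idP/imsetP => [EH | [E' E'G ->]].
  (* The edge is pulled back to the vertex type of the subgraph; nothing is lost, because its ends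
     lie in [sub_vertices]. *)
  pose E1 : {set sgraph_of_sub H} := [set x | val x \in E].
  have E1E : [set val x | x in E1] = E.
    apply/setP => x; apply/imsetP/idP => [[y]|xE]; first by rewrite in_set => ? ->.
    have xH := subsetP (sub_edges_vertices EH) x xE.
    by exists (exist _ x xH); rewrite ?in_set.
  have E1H : E1 \in edges (sgraph_of_sub H) by rewrite in_set E1E.
  have /eqP/cards2P[x [y [_ defE1]]] := edges_card2 E1H.
  case: F_bij => G FK GK.
  exists [set G x; G y]; first by rewrite -F_edges !GK -defE1.
  by rewrite mapE !GK -defE1.
have /eqP/cards2P[x [y [_ defE]]] := goldberg3_card2 E'G.
have := F_edges x y; rewrite -defE (E'G : E' \in edges goldberg3) in_set.
by rewrite defE mapE => ->.
Qed.

Lemma card_design_block B : B \in D -> #|B| = 36.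
Proof.
by case/design_block=> g g_inj ->; rewrite card_imset ?card_goldberg3 //; apply: imset_inj.
Qed.

(** A vertex has degree 3 in a block through it and degree 0 in any other. *)
Lemma degree_design_block B x : B \in D -> 3 %| \sum_(E in B) (x \in E).
Proof.
case/design_block=> g g_inj ->.
rewrite big_imset /=; last by move=> E E' _ _; apply: imset_inj.
have [/codomP[i ->] | xNg] := boolP (x \in codom g).
  by under eq_bigr do rewrite mem_imset //; rewrite degree_goldberg3.
rewrite big1 // => E _; apply/eqP; rewrite eqb0; apply: contra xNg.
by case/imsetP=> i _ ->; apply: codom_f.
Qed.

Lemma card_complete_edges : #|edges (complete n)| = 'C(n, 2).
Proof. by rewrite card_draws card_ord. Qed.

Lemma degree_complete (x : complete n) :
  \sum_(E in edges (complete n)) (x \in E) = n.-1.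
Proof.
rewrite -big_mkcondr sum1dep_card.
have -> : [set E | E \in edges (complete n) & x \in E] =
    [set [set x; y] | y in [set~ x]].
  apply/setP => E; rewrite in_set; apply/andP/imsetP => [[]|[y]].
    move=> /edges_card2/eqP/cards2P[a [b [ab ->]]]; rewrite in_set2.
    case/orP=> /eqP ->; first by exists b; rewrite // !inE eq_sym.
    by exists a; rewrite ?inE // setUC.
  by rewrite in_setC1 => yx ->; rewrite set21 in_set cards2 [x == y]eq_sym yx.
rewrite card_in_imset; first by rewrite cardsC1 card_ord.
move=> y z _ _ /eqP; rewrite eq_set2 /joins !xpair_eqE.
by case/orP=> /andP[/eqP ? /eqP ?]; subst.
Qed.

Lemma sum_design (F : {set complete n} -> nat) :
  \sum_(E in edges (complete n)) F E = \sum_(B in D) \sum_(E in B) F E.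
Proof.
by case: D_design => /and3P[/eqP <- triD _] _; rewrite big_trivIset.
Qed.

Lemma design_necessary : 0 < n -> n = 1 %[mod 72] \/ n = 64 %[mod 72].
Proof.
move=> n_gt0.
have dvd36 : 36 %| 'C(n, 2).
  rewrite -card_complete_edges -sum1_card sum_design.
  by apply: dvdn_sum => B /card_design_block BD; rewrite sum1_card BD.
have dvd3 : 3 %| n.-1.
  rewrite -(degree_complete (Ordinal n_gt0)) sum_design.
  by apply: dvdn_sum => B /degree_design_block.
have dvd72 : 72 %| n * n.-1.
  have <- : 'C(n, 2) * 2 = n * n.-1 by rewrite (bin_ffact n 2) ffactnS ffactn1.
  by rewrite (@dvdn_pmul2r 2 36).
case: n n_gt0 dvd3 dvd72 => // k _ /= dvd3 dvd72.
(* Here [k] is n - 1. As 3 divides r, the factor 9 must divide r and not r + 1, while r is 0 or 7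
   modulo 8; this leaves 0 and 63. *)
have chk : all (fun r => (72 %| r.+1 * r) && (3 %| r) ==> (r \in [:: 0; 63])) (iota 0 72).
  by vm_compute.
have /(allP chk) : k %% 72 \in iota 0 72 by rewrite mem_iota ltn_pmod.
have -> : 3 %| k %% 72 by rewrite /dvdn modn_dvdm.
have -> : 72 %| (k %% 72).+1 * (k %% 72).
  by rewrite /dvdn modnMmr -modnMml -addn1 modnDml addn1 modnMml.
rewrite !inE => /orP[]/eqP rE; [left | right];
  by rewrite -[in LHS]addn1 -modnDml rE.
Qed.

End Necessity.

(** * Group divisible designs with groups of size 6 *)

Definition level : finType := ('Z_3 * bool)%type.

(* A 3-GDD of type 6^u: [I] indexes the groups, [level] the six points of each. *)
Definition is_gdd6 (I : finType) (ts : seq (seq (I * level))) : Prop :=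
  all (fun t => (size t == 3) && uniq (map fst t)) ts /\
  forall p q, p.1 != q.1 ->
    count (fun t : seq (I * level) => (p \in t) && (q \in t)) ts = 1.

(** Counting device for the triples: prescribing two entries leaves a single candidate index [j0],
    and [b] tells whether it is admissible. *)
Lemma sum_unique (J : finType) (C : pred J) (b : bool) (j0 : J) :
  (forall j, C j = b && (j == j0)) -> \sum_j C j = b.
Proof.
move=> CE; rewrite (bigD1 j0) //= CE eqxx andbT big1 ?addn0 // => j /negbTE.
by rewrite CE => ->; rewrite andbF.
Qed.

(** The six ordered placements of two points in a triple exclude each other, so the indicator is
    their sum and can be counted placement by placement. *)
Lemma pair_in_triple (T : eqType) (p q s1 s2 s3 : T) :
    p != q -> uniq [:: s1; s2; s3] ->
  (p \in [:: s1; s2; s3]) && (q \in [:: s1; s2; s3]) =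
  ((s1 == p) && (s2 == q)) + ((s2 == p) && (s1 == q)) +
  (((s1 == p) && (s3 == q)) + ((s2 == p) && (s3 == q))) +
  (((s3 == p) && (s1 == q)) + ((s3 == p) && (s2 == q))) :> nat.
Proof.
move=> pq; rewrite /= !inE negb_or andbT => /andP[/andP[s12 s13] s23].
rewrite ![p == _]eq_sym ![q == _]eq_sym.
have pqF (s : T) : ~~ ((s == p) && (s == q)).
  by apply: contra pq => /andP[/eqP <- /eqP <-].
have sF (s s' r : T) : s != s' -> ~~ ((s == r) && (s' == r)).
  by apply: contra => /andP[/eqP -> /eqP ->].
move: (pqF s1) (pqF s2) (pqF s3) (sF _ _ p s12) (sF _ _ p s13) (sF _ _ p s23)
  (sF _ _ q s12) (sF _ _ q s13) (sF _ _ q s23).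
case: (s1 == p); case: (s2 == p); case: (s3 == p); case: (s1 == q);
  by case: (s2 == q); case: (s3 == q).
Qed.

Lemma count_map_enum (J : finType) (A : pred J) (T : Type) (F : J -> T) (P : pred T) :
  count P [seq F j | j <- enum A] = \sum_(j | A j) P (F j).
Proof. by rewrite count_map -sum1_count big_enum_cond big_mkcondr. Qed.

Section Rings.

Import GRing.Theory.
Local Open Scope ring_scope.

(** Two elements of Z_3 differ by exactly one of 0, 1, -1; this is why a pair of points falls under
    just one kind of pair in the Bose triples. *)
Lemma level_cases (i j : 'Z_3) :
  ((i == j) + (j == (i + 1)%R) + (i == (j + 1)%R))%N = 1%N.
Proof. by case: i => -[|[|[|//]]] ?; case: j => -[|[|[|//]]] ?. Qed.

Lemma sum_Z3 (F : 'Z_3 -> nat) : (\sum_t F t = F 0%R + F 1%R + F 2%R)%N.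
Proof.
rewrite (big_ord_recl (Zp_trunc 3).+1) (big_ord_recl (Zp_trunc 3)).
rewrite (big_ord_recl 0) big_ord0 addn0 addnA.
by congr (F _ + F _ + F _)%N; apply: val_inj.
Qed.

(** * Bose's construction over an odd cyclic group *)

Section OddCyclicGroup.

Variable h : nat.
Let v := h.*2.+3.

(** The inverse of 2, since 2 (h + 2) = v + 1; here [v] runs through the odd numbers from 3 on. *)
Definition halfZ : 'Z_v := h.+2%:R.

Lemma halfZD : halfZ + halfZ = 1.
Proof.
rewrite -natrD; have -> : (h.+2 + h.+2 = v + 1)%N by rewrite addnn addn1 !doubleS.
by rewrite natrD pchar_Zp // add0r.
Qed.

Lemma double_halfZ (d : 'Z_v) : halfZ * d + halfZ * d = d.
Proof. by rewrite -mulrDl halfZD mul1r. Qed.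

Lemma halfZ_double (d : 'Z_v) : halfZ * (d + d) = d.
Proof. by rewrite mulrDr double_halfZ. Qed.

(* Selects one of each pair of opposite nonzero elements. *)
Definition pos (d : 'Z_v) : bool := (nat_of_ord d < nat_of_ord (- d)%R)%N.

Lemma pos0 : pos 0 = false.
Proof. by rewrite /pos oppr0. Qed.

Lemma pos1 : pos 1.
Proof. by rewrite /pos /= !modn_small ?subn1. Qed.

Lemma posN d : d != 0 -> pos (- d) = ~~ pos d.
Proof.
move=> d0; rewrite /pos opprK ltn_neqAle -leqNgt.
case: eqP => // /val_inj dN; case/eqP: d0.
by rewrite -(halfZ_double d) -{1}dN addNr mulr0.
Qed.

Section Family.

(* With [bordered], the difference class of 1 is thinned out, which frees the
   edges that are to be joined to the six points at infinity. *)
Variable bordered : bool.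

Definition special (d : 'Z_v) : bool := bordered && (d == 1).

(** Two points of one level are joined to their midpoint on the next level. The index consists of
    the midpoint [m], the half-difference [d], the level [i] and the doubling bits of the first two
    points. Outside the special class the third bit is their sum, so any two bits fix the third.
    Bose's vertical triples are left out: doubled, they are the groups. *)
Definition bose_index : finType := ('Z_v * 'Z_v * 'Z_3 * (bool * bool))%type.

Definition bose_ok (j : bose_index) : bool :=
  let: (m, d, i, (a, b)) := j in pos d && (special d ==> (a == b)).

Definition bose1 (j : bose_index) : 'Z_v * level :=
  let: (m, d, i, (a, b)) := j in (m - d, (i, a)).

Definition bose2 (j : bose_index) : 'Z_v * level :=
  let: (m, d, i, (a, b)) := j in (m + d, (i, b)).

Definition bose3 (j : bose_index) : 'Z_v * level :=
  let: (m, d, i, (a, b)) := j in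
  (m, (i + 1, if special d then a else a (+) b)).

Let D (p q : 'Z_v * level) : 'Z_v := q.1 - p.1.

(** Here and in the next two lemmas the index is recovered from two entries: midpoint and
    half-difference solve linear equations in which 2 is invertible. *)
Lemma bose12 (p q : 'Z_v * level) :
  (\sum_j [&& bose_ok j, bose1 j == p & bose2 j == q])%N =
  [&& q.2.1 == p.2.1, pos (halfZ * D p q) &
      special (halfZ * D p q) ==> (p.2.2 == q.2.2)].
Proof.
case: p q => [x [i a]] [y [k b]] /=; rewrite /D /=.
apply: (@sum_unique _ _ _ (halfZ * (x + y), halfZ * (y - x), i, (a, b))).
move=> [[[m d] l] [a' b']]; rewrite /= !xpair_eqE.
apply/idP/idP.
  case/and3P=> ok /and3P[/eqP <- /eqP <- /eqP <-] /and3P[/eqP <- /eqP <- /eqP <-].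
  have -> : halfZ * (m + d - (m - d)) = d by rewrite -[RHS]halfZ_double; congr (_ * _); ring.
  have -> : halfZ * (m - d + (m + d)) = m by rewrite -[RHS]halfZ_double; congr (_ * _); ring.
  by rewrite ok !eqxx.
case/andP=> /and3P[/eqP -> ok1 ok2].
case/andP=> /andP[/andP[/eqP -> /eqP ->] /eqP ->] /andP[/eqP -> /eqP ->].
have -> : halfZ * (x + y) - halfZ * (y - x) = x.
  by rewrite -[RHS]halfZ_double; ring.
have -> : halfZ * (x + y) + halfZ * (y - x) = y.
  by rewrite -[RHS]halfZ_double; ring.
by rewrite ok1 ok2 !eqxx.
Qed.

Lemma bose13 (p q : 'Z_v * level) :
  (\sum_j [&& bose_ok j, bose1 j == p & bose3 j == q])%N =
  [&& q.2.1 == p.2.1 + 1, pos (D p q) & special (D p q) ==> (p.2.2 == q.2.2)].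
Proof.
case: p q => [x [i a]] [y [k b]] /=; rewrite /D /=.
(* The third entry is the midpoint [y] itself. The missing second bit is the sum of the other two,
   or their common value in the special class. *)
apply: (@sum_unique _ _ _ (y, y - x, i, (a, if special (y - x) then a else a (+) b))).
move=> [[[m d] l] [a' b']]; rewrite /= !xpair_eqE.
apply/idP/idP.
  case/and3P=> /andP[ok1 ok2] /and3P[/eqP <- /eqP <- /eqP <-] /and3P[/eqP <- /eqP <- /eqP <-].
  have -> : m - (m - d) = d by ring.
  rewrite ok1 !eqxx; move: ok2; case: (special d) => /= [/eqP -> | _]; rewrite ?eqxx //.
  by rewrite addKb.
case/andP=> /and3P[/eqP -> ok1 ok2].
case/andP=> /andP[/andP[/eqP -> /eqP ->] /eqP ->] /andP[/eqP -> /eqP ->].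
have -> : y - (y - x) = x by ring.
rewrite ok1 !eqxx; move: ok2; case: (special _) => /= [/eqP -> | _]; rewrite ?eqxx //.
by rewrite addKb.
Qed.

Lemma bose23 (p q : 'Z_v * level) :
  (\sum_j [&& bose_ok j, bose2 j == p & bose3 j == q])%N =
  [&& q.2.1 == p.2.1 + 1, pos (D q p) & special (D q p) ==> (p.2.2 == q.2.2)].
Proof.
case: p q => [x [i a]] [y [k b]] /=; rewrite /D /=.
apply: (@sum_unique _ _ _ (y, x - y, i, (if special (x - y) then a else a (+) b, a))).
move=> [[[m d] l] [a' b']]; rewrite /= !xpair_eqE.
apply/idP/idP.
  case/and3P=> /andP[ok1 ok2] /and3P[/eqP <- /eqP <- /eqP <-] /and3P[/eqP <- /eqP <- /eqP <-].
  have -> : m + d - m = d by ring.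
  rewrite ok1 !eqxx; move: ok2; case: (special d) => /= [/eqP -> | _]; rewrite ?eqxx //.
  by rewrite addbC addbK !eqxx.
case/andP=> /and3P[/eqP -> ok1 ok2].
case/andP=> /andP[/andP[/eqP -> /eqP ->] /eqP ->] /andP[/eqP -> /eqP ->].
have -> : y + (x - y) = x by ring.
rewrite ok1 !eqxx; move: ok2; case: (special _) => /= [/eqP -> | _]; rewrite ?eqxx //.
by rewrite addbC addKb.
Qed.

Definition bose_triple (j : bose_index) : seq ('Z_v * level) :=
  [:: bose1 j; bose2 j; bose3 j].

Lemma bose_triple_groups j : bose_ok j -> uniq (map fst (bose_triple j)).
Proof.
case: j => [[[m d] i] [a b]] /= /andP[pd _].
have d0 : d != 0 by apply: contraTneq pd => ->; rewrite pos0.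
rewrite !inE !andbT negb_or.
have m1 : m - d != m by rewrite -subr_eq0 addrAC subrr add0r oppr_eq0.
have m2 : m + d != m by rewrite -subr_eq0 addrAC subrr add0r.
rewrite m1 m2 andbT -subr_eq0.
have -> : m - d - (m + d) = - (d + d) by ring.
rewrite andbT oppr_eq0; apply: contra_neq d0 => dd0.
by rewrite -(halfZ_double d) dd0 mulr0.
Qed.

Definition near (d : 'Z_v) : bool := special d || special (- d).

Let HD (p q : 'Z_v * level) : 'Z_v := halfZ * D p q.

(** Exactly one of d and -d is selected by [pos], so the two placements of a pair of given levels
    merge into one term. In the thinned class only pairs with equal doubling bits remain covered. *)
Lemma bose_count (p q : 'Z_v * level) : p.1 != q.1 ->
  (\sum_(j | bose_ok j) ((p \in bose_triple j) && (q \in bose_triple j)))%N =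
  ((q.2.1 == p.2.1) && (near (HD p q) ==> (p.2.2 == q.2.2)) +
   (q.2.1 == p.2.1 + 1)%R && (near (D p q) ==> (p.2.2 == q.2.2)) +
   (p.2.1 == q.2.1 + 1)%R && (near (D p q) ==> (p.2.2 == q.2.2)))%N.
Proof.
move=> pq.
have pq' : p != q by apply: contra_neq pq => ->.
transitivity (\sum_j (
  ([&& bose_ok j, bose1 j == p & bose2 j == q] + [&& bose_ok j, bose1 j == q & bose2 j == p]) +
  ([&& bose_ok j, bose1 j == p & bose3 j == q] + [&& bose_ok j, bose2 j == p & bose3 j == q]) +
  ([&& bose_ok j, bose1 j == q & bose3 j == p] + [&& bose_ok j, bose2 j == q & bose3 j == p])))%N.
  rewrite big_mkcond; apply: eq_bigr => j _; case: ifP => //= okj.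
  rewrite pair_in_triple // ?(map_uniq (bose_triple_groups okj)) //.
  by rewrite [(bose1 j == q) && _]andbC [(bose1 j == q) && _]andbC [(bose2 j == q) && _]andbC.
rewrite !big_split /= !bose12 !bose13 !bose23.
have DN : D q p = - D p q by rewrite /D opprB.
have D0 : D p q != 0 by rewrite /D subr_eq0 eq_sym.
have hD0 : halfZ * D p q != 0.
  by apply: contra_neq D0 => E; rewrite -(double_halfZ (D p q)) E addr0.
have hDN : halfZ * D q p = - (halfZ * D p q) by rewrite DN mulrN.
have sp d : special d -> pos d by case/andP=> _ /eqP ->; apply: pos1.
have key d c : d != 0 ->
    (pos d && (special d ==> c) + pos (- d) && (special (- d) ==> c) =
     (near d ==> c))%N.
  move=> d0; have := sp d; have := sp (- d); rewrite /near posN //.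
  by case: (pos d); case: (special d); case: (special (- d)); case: c => // H1 H2;
    try (by have := H1 isT); by have := H2 isT.
rewrite hDN DN -/(HD p q) [p.2.1 == q.2.1]eq_sym [q.2.2 == p.2.2]eq_sym.
have key' d c : d != 0 ->
    (pos (- d) && (special (- d) ==> c) + pos d && (special d ==> c) =
     (near d ==> c))%N by move=> d0; rewrite addnC key.
by case: (q.2.1 == p.2.1); case: (q.2.1 == _); case: (p.2.1 == _);
  rewrite /= ?addn0 ?add0n ?key ?key'.
Qed.

End Family.

Lemma special_false d : special false d = false. Proof. by []. Qed.

Lemma gdd6_odd : exists ts, @is_gdd6 'Z_v ts.
Proof.
exists [seq bose_triple false j | j <- enum (bose_ok false)]; split.
  apply/allP => _ /mapP[j okj ->]; rewrite mem_enum in okj.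
  by rewrite (bose_triple_groups okj).
move=> p q pq; rewrite count_map_enum bose_count // /near !special_false !andbT.
by rewrite [q.2.1 == p.2.1]eq_sym level_cases.
Qed.

(** * The bordered construction, with a group at infinity *)

Definition border_step (t : 'Z_3) (s : bool) : 'Z_v :=
  let d := if t == 0 then 1 + 1 else 1 in if s then d else - d.

Definition border_shift (t : 'Z_3) : 'Z_3 := if t == 0 then 0 else 1.

(** The uncovered pairs have opposite bits and differ by 2 or -2 on one level, or by 1 or -1 between
    adjacent levels. The sign [s] and the kind [t] (one level for 0; adjacent levels for 1 and 2,
    according to the bit on level i, the other level being i + 1) select a perfect matching between
    the points of bit 0 and those of bit 1, which is joined to the infinite point (t, s). *)
Definition border_index : finType := (level * ('Z_v * 'Z_3))%type.

Definition border1 (j : border_index) : option 'Z_v * level := (None, j.1).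

Definition border2 (j : border_index) : option 'Z_v * level :=
  (Some j.2.1, (j.2.2, j.1.1 == 2)).

Definition border3 (j : border_index) : option 'Z_v * level :=
  (Some (j.2.1 + border_step j.1.1 j.1.2),
   (j.2.2 + border_shift j.1.1, j.1.1 != 2)).

Definition border_triple (j : border_index) : seq (option 'Z_v * level) :=
  [:: border1 j; border2 j; border3 j].

Lemma two_neq0 : 1 + 1 != 0 :> 'Z_v.
Proof.
apply: contra_neq (oner_neq0 'Z_v) => E.
by rewrite -(halfZ_double 1) E mulr0.
Qed.

Lemma border_step_neq0 t s : border_step t s != 0.
Proof.
rewrite /border_step; case: (t == 0); case: s; rewrite ?oppr_eq0 ?two_neq0 //;
  exact: oner_neq0.
Qed.

Lemma border_triple_groups j : uniq (map fst (border_triple j)).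
Proof.
rewrite /= !inE /= andbT; apply: contraTneq isT => -[E].
have := border_step_neq0 j.1.1 j.1.2.
by rewrite -(inj_eq (addrI j.2.1)) addr0 -E eqxx.
Qed.

(** Once the infinite point is chosen the index is forced, so only a sum over six matchings remains;
    the two signs combine into [near]. *)
Lemma border23 (x : 'Z_v) (i : 'Z_3) (a : bool) (y : 'Z_v) (k : 'Z_3) (b : bool) :
  (\sum_j ((border2 j == (Some x, (i, a))) && (border3 j == (Some y, (k, b)))))%N =
  ([&& ~~ a, b, k == i & near true (halfZ * (y - x))%R] +
   ((a (+) b) && (k == i + 1)%R && near true (y - x)%R))%N.
Proof.
pose C t s := [&& a == (t == 2%R :> 'Z_3), b == (t != 2%R :> 'Z_3),
  k == (i + border_shift t)%R & y == (x + border_step t s)%R].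
transitivity (\sum_t \sum_s C t s)%N.
  rewrite [in RHS]pair_bigA /=; transitivity (\sum_(u : level) \sum_(w : 'Z_v * 'Z_3)
    ((border2 (u, w) == (Some x, (i, a))) && (border3 (u, w) == (Some y, (k, b)))))%N.
    by rewrite pair_bigA /=; apply: eq_bigr => -[].
  apply: eq_bigr => -[t s] _ /=.
  apply: (@sum_unique _ _ _ (x, i)) => -[x' i']; rewrite /C /= !xpair_eqE /=.
  apply/idP/idP.
    case/andP=> /and3P[/eqP[<-] /eqP <- /eqP <-] /and3P[/eqP[<-] /eqP <- /eqP <-].
    by rewrite !eqxx.
  by case/andP=> /and4P[/eqP -> /eqP -> /eqP -> /eqP ->] /andP[/eqP -> /eqP ->]; rewrite !eqxx.
(* The two signs give different neighbours, since [v] is odd. *)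
have nearE (d : 'Z_v) : d != - d -> ((y == (x + d)%R) + (y == (x - d)%R))%N =
    (y - x == d) || (- (y - x) == d).
  move=> dN; rewrite [- _ == d]eqr_oppLR ![y - x == _]subr_eq ![_ + x]addrC.
  by case: eqP => [->|] //=; case: eqP => // /addrI/eqP; rewrite (negbTE dN).
have neqN (d : 'Z_v) : d != 0 -> d != - d.
  by apply: contra_neq => E; rewrite -(halfZ_double d) {1}E addNr mulr0.
have near1 : ((y == (x + 1)%R) + (y == (x - 1)%R))%N = near true (y - x).
  exact: nearE (neqN _ (oner_neq0 _)).
have near2 : ((y == (x + (1 + 1))%R) + (y == (x - (1 + 1))%R))%N =
    near true (halfZ * (y - x)).
  rewrite nearE ?neqN ?two_neq0 // /near /special /=.
  have eqh (d : 'Z_v) : (halfZ * d == 1) = (d == 1 + 1).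
    apply/eqP/eqP => [E|->]; last by rewrite halfZ_double.
    by rewrite -(double_halfZ d) E.
  by rewrite -mulrN !eqh.
rewrite sum_Z3 !big_bool /C /border_step /border_shift /= addr0.
case: a {C}; case: b => //=; case: (k == i); case: (k == i + 1);
  by rewrite //= ?near1 ?near2 ?addn0 ?add0n.
Qed.

Lemma gdd6_even : exists ts, @is_gdd6 (option 'Z_v) ts.
Proof.
pose to_point (p : 'Z_v * level) : option 'Z_v * level := (Some p.1, p.2).
have to_point_inj : injective to_point by move=> [x l] [y l'] [-> ->].
exists ([seq map to_point (bose_triple true j) | j <- enum (bose_ok true)] ++
        [seq border_triple j | j <- enum border_index]); split.
  rewrite all_cat; apply/andP; split; apply/allP => _ /mapP[j okj ->].
    rewrite mem_enum in okj; rewrite size_map -map_comp.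
    by rewrite (map_comp Some fst) map_inj_uniq ?bose_triple_groups //; apply: Some_inj.
  by rewrite border_triple_groups.
have symm (p q : option 'Z_v * level) ts :
    count (fun t : seq _ => (p \in t) && (q \in t)) ts =
    count (fun t : seq _ => (q \in t) && (p \in t)) ts.
  by apply: eq_count => t; rewrite andbC.
have border_count (p q : option 'Z_v * level) : p.1 != q.1 ->
  (\sum_j ((p \in border_triple j) && (q \in border_triple j)) =
   \sum_j (((border1 j == p) && (border2 j == q)) + ((border2 j == p) && (border1 j == q)) +
  (((border1 j == p) && (border3 j == q)) + ((border2 j == p) && (border3 j == q))) +
  (((border3 j == p) && (border1 j == q)) + ((border3 j == p) && (border2 j == q)))))%N.
  move=> pq; apply: eq_bigr => j _; rewrite pair_in_triple //.
    by apply: contra_neq pq => ->.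
  exact: map_uniq (border_triple_groups j).
(* A finite point has one partner in the matching of [l]; its bit decides whether it is the second
   or the third entry. *)
have inf_count (l : level) (q : 'Z_v * level) :
    (\sum_j (((None, l) \in border_triple j) && (to_point q \in border_triple j)))%N = 1%N.
  case: l q => [t s] [y [k b]]; rewrite border_count //.
  transitivity (\sum_j (((border1 j == (None, (t, s))) && (border2 j == (Some y, (k, b)))) +
    ((border1 j == (None, (t, s))) && (border3 j == (Some y, (k, b))))))%N.
    by apply: eq_bigr => j _; rewrite !andbF !addn0.
  rewrite big_split /=.
  rewrite (@sum_unique _ _ (b == (t == 2)) ((t, s), (y, k))); last first.
    move=> [[t' s'] [y' k']]; rewrite /border1 /border2 /to_point /= !xpair_eqE /=.
    apply/idP/idP.
      by case/andP=> /andP[/eqP <- /eqP <-] /and3P[/eqP[<-] /eqP <- /eqP <-]; rewrite !eqxx.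
    case/andP=> /eqP -> /andP[/andP[/eqP -> /eqP ->] /andP[/eqP -> /eqP ->]].
    by rewrite !eqxx.
  rewrite (@sum_unique _ _ (b == (t != 2))
    ((t, s), (y - border_step t s, k - border_shift t))); last first.
    move=> [[t' s'] [y' k']]; rewrite /border1 /border3 /to_point /= !xpair_eqE /=.
    apply/idP/idP.
      case/andP=> /andP[/eqP <- /eqP <-] /and3P[/eqP[<-] /eqP <- /eqP <-].
      by rewrite !addrK !eqxx.
    case/andP=> /eqP -> /andP[/andP[/eqP -> /eqP ->] /andP[/eqP -> /eqP ->]].
    by rewrite !subrK !eqxx.
  by case: b; case: (t == 2).
have to_point_count (l : level) (q : option 'Z_v * level) :
    (\sum_(j | bose_ok true j) (((None, l) \in map to_point (bose_triple true j)) &&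
       (q \in map to_point (bose_triple true j))))%N = 0%N.
  by apply: big1 => j _; rewrite !inE.
move=> p q pq.
(* Two infinite points share a group, so one of the points is finite. *)
wlog [x [i [a defp]]] : p q pq / exists x i a, p = (Some x, (i, a)).
  case: p pq => [[x|] [i a]] pq wl; first by apply: wl => //; exists x, i, a.
  case: q pq => [[y|] [k b]] // pq.
  by rewrite symm wl //; exists y, k, b.
subst p; rewrite count_cat !count_map_enum.
case: q pq => [[y|] [k b]] pq; last first.
  under eq_bigr do rewrite andbC.
  under [X in (_ + X)%N]eq_bigr do rewrite andbC.
  by rewrite to_point_count (inf_count (k, b) (x, (i, a))).
have -> : (\sum_(j | bose_ok true j) (((Some x, (i, a)) \in map to_point (bose_triple true j)) &&
       ((Some y, (k, b)) \in map to_point (bose_triple true j))) =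
   \sum_(j | bose_ok true j) (((x, (i, a)) \in bose_triple true j) &&
       ((y, (k, b)) \in bose_triple true j)))%N.
  by apply: eq_bigr => j _; rewrite -!(mem_map to_point_inj).
rewrite bose_count /=; last by apply: contra_neq pq => /= ->.
rewrite border_count //.
have -> : (\sum_j (((border1 j == (Some x, (i, a))) && (border2 j == (Some y, (k, b)))) +
    ((border2 j == (Some x, (i, a))) && (border1 j == (Some y, (k, b)))) +
    (((border1 j == (Some x, (i, a))) && (border3 j == (Some y, (k, b)))) +
     ((border2 j == (Some x, (i, a))) && (border3 j == (Some y, (k, b))))) +
    (((border3 j == (Some x, (i, a))) && (border1 j == (Some y, (k, b)))) +
     ((border3 j == (Some x, (i, a))) && (border2 j == (Some y, (k, b)))))) =
  \sum_j (((border2 j == (Some x, (i, a))) && (border3 j == (Some y, (k, b)))) +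
    ((border2 j == (Some y, (k, b))) && (border3 j == (Some x, (i, a))))))%N.
  by apply: eq_bigr => j _; rewrite [(border3 j == _) && (border2 j == _)]andbC !andbF !add0n.
rewrite big_split /=.
rewrite !border23.
have nearN d : near true (- d) = near true d by rewrite /near opprK orbC.
have -> : halfZ * (x - y) = - (halfZ * (y - x)) by ring.
have -> : x - y = - (y - x) by ring.
rewrite !nearN.
(* What remains is a case check: the pairs with opposite bits missing from the thinned class are
   those added by the matchings. *)
have := level_cases i k; rewrite [k == i]eq_sym.
case: (i == k); case: (k == i + 1); case: (i == k + 1) => //= _;
  by case: a {pq}; case: b; case: (near true _); case: (near true _).
Qed.

End OddCyclicGroup.

End Rings.

(** * Inflating the points of a group divisible design *)

Section Weighting.

Variables (I : finType) (w : I * level -> nat).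

(** [None] is the extra point common to all filled groups; [Some (p, k)] is copy [k] of the point
    [p]. *)
Let T : eqType := option ((I * level) * nat).

Definition inflate (t : seq (I * level)) (x y : T) : nat :=
  if (x, y) is (Some (p, k), Some (q, l))
  then [&& p \in t, q \in t, p != q, k < w p & l < w q] else 0.

Definition inflated_point (x : T) : bool :=
  if x is Some (p, k) then k < w p else true.

Definition inflated_group (g : I) (x : T) : bool :=
  if x is Some (p, k) then (p.1 == g) && (k < w p) else true.

Lemma inflate_tripartite p q r : uniq [:: p; q; r] -> w p = 12 -> w q = 12 ->
  decomposable (tripartite (w r)) -> decomposable (inflate [:: p; q; r]).
Proof.
set t := [:: p; q; r] => t_uniq wp wq.
(* The three parts start at 0, 12 and 24, so subtracting 12 times the part number gives the copy. *)
pose h n : T := Some (nth p t (part n), n - 12 * part n).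
have part3 n : part n < size t by rewrite /part /=; lia.
have wE n : n < 24 + w r -> n - 12 * part n < w (nth p t (part n)).
  have : [|| part n == 0, part n == 1 | part n == 2] by rewrite /part; lia.
  by case/or3P=> /eqP E; rewrite E /= ?wp ?wq; move: E; rewrite /part; lia.
apply: (@decomposable_map _ _ h (fun n => n < 24 + w r)).
- move=> n m nP mP [/eqP]; rewrite nth_uniq // => /eqP E.
  by move: (nP : n < _) (mP : m < _) E; rewrite /part; lia.
- by move=> n m; rewrite /tripartite lt0b => /andP[].
- move=> n m nP mP; rewrite /inflate /h !mem_nth // nth_uniq // !wE //.
  by rewrite /tripartite (nP : n < _) (mP : m < _) !andbT.
move=> [[p' k]|//] [[q' l]|//]; rewrite /inflate lt0b.
case/and5P=> p't q't _ kw lw.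
have hE p'' k' : p'' \in t -> k' < w p'' ->
    exists2 n, n < 24 + w r & Some (p'', k') = h n.
  move=> p''t k'w; pose i := index p'' t.
  have i3 : i < 3 by rewrite -/(size t) index_mem.
  have ip : nth p t i = p'' by rewrite nth_index.
  have [partE lt_r] : part (12 * i + k') = i /\ 12 * i + k' < 24 + w r.
    move: i3 ip k'w; case: i => [|[|[|//]]] _ /= <-; rewrite ?wp ?wq /part; lia.
  by exists (12 * i + k') => //; rewrite /h partE ip addKn.
have [n nP ->] := hE _ _ p't kw; have [m mP ->] := hE _ _ q't lw.
by exists n, m.
Qed.

Hypothesis w_tripartite : forall p, decomposable (tripartite (w p)).
Hypothesis w12 : forall p q, p.1 != q.1 -> (w p == 12) || (w q == 12).

(** By [w12] at most one point of the triple has a weight other than 12; reordering puts it last. *)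
Lemma inflate_triple t : size t = 3 -> uniq (map fst t) -> decomposable (inflate t).
Proof.
case: t => [|p [|q [|r [|]]]] // _ t_groups.
have t_uniq : uniq [:: p; q; r] := map_uniq t_groups.
move: t_groups; rewrite /= !inE negb_or andbT => /andP[/andP[pq pr] qr].
have perm t' : perm_eq t' [:: p; q; r] -> decomposable (inflate t') ->
    decomposable (inflate [:: p; q; r]).
  move=> /perm_mem eq_t; apply: eq_decomposable => -[[p' k]|] [[q' l]|] //.
  by rewrite /inflate !eq_t.
have [/eqP wp | /negbTE wp] := boolP (w p == 12); last first.
  have wq : w q = 12 by apply/eqP; have := w12 pq; rewrite wp.
  have wr : w r = 12 by apply/eqP; have := w12 pr; rewrite wp.
  apply: (perm [:: q; r; p]); first by rewrite (perm_catCA [:: q; r] [:: p] [::]).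
  apply: inflate_tripartite => //.
  by rewrite (perm_uniq (s2 := [:: p; q; r])) // (perm_catCA [:: q; r] [:: p] [::]).
have [/eqP wq | /negbTE wq] := boolP (w q == 12).
  exact: inflate_tripartite.
have wr : w r = 12 by apply/eqP; have := w12 qr; rewrite wq.
apply: (perm [:: p; r; q]); first by rewrite perm_cons (perm_catC [:: r] [:: q]).
apply: inflate_tripartite => //.
by rewrite (perm_uniq (s2 := [:: p; q; r])) // perm_cons (perm_catC [:: r] [:: q]).
Qed.

Lemma inflate_group g : complete_decomposable (1 + \sum_l w (g, l)) ->
  decomposable (clique (inflated_group g)).
Proof.
pose s : seq T :=
  None :: [seq Some ((g, l), k) | l <- enum level, k <- iota 0 (w (g, l))].
have s_uniq : uniq s.
  rewrite /= allpairs_uniq_dep ?enum_uniq //=; last 2 first.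
  - by move=> l _; apply: iota_uniq.
  - by move=> [l k] [l' k'] _ _ /= [-> ->].
  by rewrite andbT; apply/negP => /allpairsPdep[l [k []]].
have -> : 1 + \sum_l w (g, l) = size s.
  rewrite /= size_allpairs_dep add1n -big_enum /=; congr _.+1.
  by rewrite sumnE big_map; apply: eq_bigr => l _; rewrite size_iota.
move=> /(complete_decomposable_mem s_uniq); apply: eq_decomposable => x y.
have memE z : (z \in s) = inflated_group g z.
  case: z => [[[g' l] k]|] //=; rewrite inE /=.
  apply/allpairsPdep/andP => [[l' [k' [_]]]|[/eqP /= -> kw]].
    by rewrite mem_iota add0n => kw [-> -> ->].
  by exists l, k; rewrite mem_enum mem_iota.
by rewrite /clique !memE.
Qed.

(** Copies of points in different groups are joined by the one triple through these points. Copies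
    over a single group, and pairs with [None], are joined only when that group is filled. *)
Lemma inflate_gdd ts : @is_gdd6 I ts ->
    (forall g, complete_decomposable (1 + \sum_l w (g, l))) ->
  complete_decomposable (1 + \sum_g \sum_l w (g, l)).
Proof.
move=> [ts_triples ts_cover] dec_g.
pose s : seq T := None :: [seq Some (p, k) | p <- enum {: I * level}, k <- iota 0 (w p)].
have s_uniq : uniq s.
  rewrite /= allpairs_uniq_dep ?enum_uniq //=; last 2 first.
  - by move=> l _; apply: iota_uniq.
  - by move=> [l k] [l' k'] _ _ /= [-> ->].
  by rewrite andbT; apply/negP => /allpairsPdep[l [k []]].
have -> : 1 + \sum_g \sum_l w (g, l) = size s.
  rewrite /= size_allpairs_dep add1n pair_bigA /= -big_enum /=; congr _.+1.
  by rewrite sumnE big_map; apply: eq_bigr => -[g l] _; rewrite size_iota.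
apply: decomposable_mem_complete => //.
have memE z : (z \in s) = inflated_point z.
  case: z => [[p k]|] //=; rewrite inE /=.
  apply/allpairsPdep/idP => [[l' [k' [_]]]|kw].
    by rewrite mem_iota add0n => kw [-> ->].
  by exists p, k; rewrite mem_enum mem_iota.
have dec_t : decomposable (fun x y => \sum_(t <- ts) inflate t x y).
  by apply: decomposable_sum => t /(allP ts_triples)/andP[/eqP]; apply: inflate_triple.
have dec_s : decomposable (fun x y => \sum_g clique (inflated_group g) x y).
  by apply: decomposable_sum => g _; apply: inflate_group.
apply: eq_decomposable (decomposableD dec_t dec_s) => x y.
rewrite /clique !memE.
have [-> | xy] := eqVneq x y.
  rewrite /= [X in _ + X]big1 => [|g _]; last by [].
  rewrite addn0 big1 // => t _; rewrite /inflate.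
  by case: y => [[p k]|] //; rewrite eqxx !andbF.
case: x y xy => [[p k]|] [[q l]|] //= xy.
- have [Epq | Npq] := eqVneq p.1 q.1.
    rewrite big1_seq ?add0n => [|t /= /(allP ts_triples) /andP[_ t_groups]]; last first.
      rewrite /inflate; case: (boolP [&& _, _, _, _ & _]) => //.
      case/and5P=> pt qt /eqP[]; exact: uniq_map_inj t_groups _ _ pt qt Epq.
    rewrite (@sum_unique _ _ ((k < w p) && (l < w q)) p.1) // => g.
    by rewrite -Epq [g == _]eq_sym /=; case: (p.1 == g); rewrite ?andbF ?andbT.
  rewrite [X in _ + X]big1 ?addn0 => [|g _]; last first.
    rewrite [X in nat_of_bool X](_ : _ = false) //.
    by case: (eqVneq p.1 g) => [<-|] /=; rewrite ?andbF // eq_sym (negbTE Npq) !andbF.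
  have pq : p != q by apply: contra_neq Npq => ->.
  rewrite (eq_bigr (fun t : seq (I * level) =>
    ((p \in t) && (q \in t)) * ((k < w p) && (l < w q)))); last first.
    move=> t _; rewrite /inflate pq /=.
    by case: (p \in t); case: (q \in t); rewrite ?mul1n ?mul0n.
  by rewrite -big_distrl /= -big_mkcond sum1_count ts_cover // mul1n.
- rewrite big1 ?add0n => [|t _]; last by [].
  rewrite (@sum_unique _ _ (k < w p) p.1) ?andbT // => g.
  by rewrite andbT [g == _]eq_sym andbC.
- rewrite big1 ?add0n => [|t _]; last by [].
  rewrite (@sum_unique _ _ (l < w q) q.1) ?andbT // => g.
  by rewrite [g == _]eq_sym andbC.
Qed.

End Weighting.

(** * The two weightings and the resulting orders *)

Definition exceptional_weight (l : level) : nat :=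
  if l.2 then 6 else if l.1 == 0%R then 21 else 12.

Lemma sum_exceptional_weight : \sum_l exceptional_weight l = 63.
Proof. by rewrite -(pair_bigA _ (fun t s => exceptional_weight (t, s))) sum_Z3 !big_bool. Qed.

Lemma sum_level12 : \sum_(l : level) 12 = 72.
Proof. by rewrite sum_nat_const card_prod card_bool card_ord. Qed.

Lemma complete_decomposable_mod1 (I : finType) ts : @is_gdd6 I ts ->
  complete_decomposable (72 * #|I| + 1).
Proof.
move=> gdd; rewrite addnC.
have -> : 72 * #|I| = \sum_(g : I) \sum_(l : level) 12.
  by rewrite sum_level12 sum_nat_const mulnC.
apply: (@inflate_gdd I (fun=> 12) _ _ ts) => //.
- by move=> _; apply: tripartite12.
- by move=> _; rewrite sum_level12; apply: complete_decomposable73.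
Qed.

(** The group [g0] has total weight 63 instead of 72, which lowers 72 u + 1 by 9. All other weights
    are 12, so triples meet an exceptional weight at most once. *)
Lemma complete_decomposable_mod64 (I : finType) ts (g0 : I) : @is_gdd6 I ts ->
  complete_decomposable (72 * #|I|.-1 + 64).
Proof.
move=> gdd.
pose w (p : I * level) := if p.1 == g0 then exceptional_weight p.2 else 12.
have sum_w g : \sum_l w (g, l) = if g == g0 then 63 else 72.
  rewrite /w /=; case: eqP => _; first exact: sum_exceptional_weight.
  exact: sum_level12.
have -> : 72 * #|I|.-1 + 64 = 1 + \sum_g \sum_l w (g, l).
  rewrite (eq_bigr _ (fun g _ => sum_w g)) (bigD1 g0) //= eqxx.
  rewrite (eq_bigr (fun=> 72)); last by move=> g /negbTE ->.
  by rewrite sum_nat_const cardC1 addnA addnC mulnC.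
apply: (inflate_gdd _ _ gdd).
- move=> [g l]; rewrite /w /=; case: eqP => _; last exact: tripartite12.
  rewrite /exceptional_weight; case: ifP => _; first exact: tripartite6.
  by case: ifP => _; [apply: tripartite21 | apply: tripartite12].
- move=> p q pq; rewrite /w; have [E|] := eqVneq p.1 g0; last by [].
  by rewrite -E [q.1 == _]eq_sym (negbTE pq) orbT.
- move=> g; rewrite sum_w; case: eqP => _; first exact: complete_decomposable64.
  exact: complete_decomposable73.
Qed.

Lemma gdd6_exists u : 2 < u -> exists (I : finType) ts, #|I| = u /\ @is_gdd6 I ts.
Proof.
move=> u_gt2.
have [odd_u | even_u] := boolP (odd u).
  (* The parameter solves 2 h + 3 = u here, and 2 h + 3 = u - 1 in the even case, where the border
     adds one group. *)
  have [ts gdd] := gdd6_odd (u./2).-1.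
  exists 'Z_((u./2).-1.*2.+3), ts; split=> //; rewrite card_ord.
  rewrite Zp_cast //; lia.
have [ts gdd] := gdd6_even (u./2).-2.
exists (option 'Z_((u./2).-2.*2.+3)), ts; split=> //; rewrite card_option card_ord.
rewrite Zp_cast //; lia.
Qed.

Theorem theorem5 (n : nat) (n_gt0 : 0 < n) :
  (exists D : {set {set {set complete n}}}, is_design goldberg3 D) <->
  (n = 1 %[mod 72] \/ n = 64 %[mod 72]).
Proof.
split=> [[D D_design] | n_mod]; first exact: design_necessary D_design n_gt0.
apply: design_of_decomposable.
have [[t ->] | [t ->]] : (exists t, n = 72 * t + 1) \/ (exists t, n = 72 * t + 64).
  by case: n_mod => n_mod; [left | right]; exists (n %/ 72);
    rewrite [LHS](divn_eq n 72) n_mod mulnC.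
- case: t => [|[|[|t]]].
  + by apply: eq_decomposable (decomposable0 _) => -[|x] [|y]; rewrite /clique ?andbF.
  + exact: complete_decomposable73.
  + exact: complete_decomposable145.
  have [I [ts [<- gdd]]] := @gdd6_exists t.+3 isT.
  exact: complete_decomposable_mod1 gdd.
- case: t => [|[|t]].
  + exact: complete_decomposable64.
  + exact: complete_decomposable136.
  (* The order is now 72 (t + 2) + 64: one group is exceptional, so t + 3 groups are taken. *)
  have [I [ts [cardI gdd]]] := @gdd6_exists t.+3 isT.
  have [g0 _] : exists g0, g0 \in I by apply/card_gt0P; rewrite cardI.
  by have := complete_decomposable_mod64 g0 gdd; rewrite cardI.
Qed.
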